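(* Rotational surfaces in the isotropic 3-space $\mathbb{I}^{3}$ are Weingarten surfaces. That is, let $g\in C^{2}$ with $\frac{dg}{du}\neq 0$, and let $\mathcal{M}$ be the rotational surface in $\mathbb{I}^3$ given by $\mathbf{X}(u,v)=(u\cos v,u\sin v,g(u))$ or by $\mathbf{X}(u,v)=(-u\sin v,u\cos v,g(u))$. Then the relative curvature $K$ and the isotropic mean curvature $H$ of $\mathcal{M}$ depend only on the variable $u$, namely $\left|\frac{\partial(K,H)}{\partial(u,v)}\right|=0$, so $\mathcal{M}$ is a Weingarten surface.
   Context: The isotropic 3-space $\mathbb{I}^3$ is $\mathbb{R}^3$ with affine coordinates $(\mathbf{x},\mathbf{y},\mathbf{z})$ and the degenerate metric $d\mathbf{x}^2+d\mathbf{y}^2$. Its group of motions consists of the maps $\mathbf{x}'=c_1+\mathbf{x}\cos c_2-\mathbf{y}\sin c_2$, $\mathbf{y}'=c_3+\mathbf{x}\sin c_2+\mathbf{y}\cos c_2$, $\mathbf{z}'=c_4+c_5\mathbf{x}+c_6\mathbf{y}+\mathbf{z}$ with $c_1,\dots,c_6\in\mathbb{R}$. A rotational surface is obtained by rotating about the $\mathbf{z}$-axis a curve $u\mapsto(u,0,g(u))$ in the isotropic $\mathbf{x}\mathbf{z}$-plane, or similarly a curve $u\mapsto(0,u,g(u))$ in the isotropic $\mathbf{y}\mathbf{z}$-plane, where $g\in C^2$ and $\frac{dg}{du}\neq 0$. All surfaces are assumed regular and admissible, i.e. without isotropic tangent planes (no tangent plane is parallel to the $\mathbf{z}$-axis).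 For such a surface $\mathbf{X}(u,v)$, $E,F,G$ are the coefficients of the first fundamental form induced by $d\mathbf{x}^2+d\mathbf{y}^2$. The coefficients $L,M,N$ of the second fundamental form are taken with respect to the isotropic normal field $(0,0,1)$: they are the coefficients of $(0,0,1)$ when $\mathbf{X}_{uu}$, $\mathbf{X}_{uv}$, $\mathbf{X}_{vv}$, respectively, are expressed in the frame $\mathbf{X}_u,\mathbf{X}_v,(0,0,1)$. The relative curvature and the isotropic mean curvature are $$K=\frac{LN-M^2}{EG-F^2},\qquad H=\frac{EN-2FM+GL}{EG-F^2}$$ (the mean curvature is normalized without the factor $1/2$). A surface is called a Weingarten surface if it satisfies a non-trivial functional relation $\delta(K,H)=0$, which is taken to be equivalent to the vanishing of the Jacobian determinant, $\left|\frac{\partial(K,H)}{\partial(u,v)}\right|=0$, for a coordinate pair $(u,v)$ on the surface. *)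

(* Defs.v *)
From Stdlib Require Import Reals.
From Coquelicot Require Import Coquelicot.
Open Scope R_scope.

(* The point (x, y, z) of isotropic 3-space is the triple ((x, y), z). *)
Definition I3 : Type := (R * R * R)%type.
Definition px (p : I3) : R := fst (fst p).
Definition py (p : I3) : R := snd (fst p).
Definition pz (p : I3) : R := snd p.

Definition I3_lin (a : R) (p : I3) (b : R) (q : I3) : I3 :=
  (a * px p + b * px q, a * py p + b * py q, a * pz p + b * pz q).

(* The isotropic direction, which is also the isotropic normal field. *)
Definition e3 : I3 := (0, 0, 1).

(* The degenerate metric dx^2 + dy^2. *)
Definition iso_dot (p q : I3) : R := px p * px q + py p * py q.

Definition partial_u (f : R -> R -> R) (u v : R) : R := Derive (fun t => f t v) u.
Definition partial_v (f : R -> R -> R) (u v : R) : R := Derive (fun t => f u t) v.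

Definition surface : Type := R -> R -> I3.

Definition d_u (X : surface) : surface := fun u v =>
  (partial_u (fun s t => px (X s t)) u v,
   partial_u (fun s t => py (X s t)) u v,
   partial_u (fun s t => pz (X s t)) u v).
Definition d_v (X : surface) : surface := fun u v =>
  (partial_v (fun s t => px (X s t)) u v,
   partial_v (fun s t => py (X s t)) u v,
   partial_v (fun s t => pz (X s t)) u v).

Definition regular_at (X : surface) (u v : R) : Prop :=
  forall a b : R,
    I3_lin a (d_u X u v) b (d_v X u v) = (0, 0, 0) -> a = 0 /\ b = 0.

(* The tangent plane at (u, v) is not parallel to the z-axis. *)
Definition admissible_at (X : surface) (u v : R) : Prop :=
  ~ exists a b : R, I3_lin a (d_u X u v) b (d_v X u v) = e3.

Definition form_E (X : surface) (u v : R) : R := iso_dot (d_u X u v) (d_u X u v).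
Definition form_F (X : surface) (u v : R) : R := iso_dot (d_u X u v) (d_v X u v).
Definition form_G (X : surface) (u v : R) : R := iso_dot (d_v X u v) (d_v X u v).

(* The coefficient of e3 when w is expressed in the frame p, q, e3.  [iota] is
   definite description; the coefficient exists and is unique as soon as
   p, q, e3 is a frame, i.e. at every regular admissible point. *)
Definition normal_coef (p q w : I3) : R :=
  iota (fun l : R => exists a b : R, w = I3_lin 1 (I3_lin a p b q) l e3).

Definition form_L (X : surface) (u v : R) : R :=
  normal_coef (d_u X u v) (d_v X u v) (d_u (d_u X) u v).
Definition form_M (X : surface) (u v : R) : R :=
  normal_coef (d_u X u v) (d_v X u v) (d_v (d_u X) u v).
Definition form_N (X : surface) (u v : R) : R :=
  normal_coef (d_u X u v) (d_v X u v) (d_v (d_v X) u v).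

Definition relative_curvature (X : surface) (u v : R) : R :=
  (form_L X u v * form_N X u v - form_M X u v ^ 2)
  / (form_E X u v * form_G X u v - form_F X u v ^ 2).

(* Normalized without the factor 1/2. *)
Definition iso_mean_curvature (X : surface) (u v : R) : R :=
  (form_E X u v * form_N X u v - 2 * form_F X u v * form_M X u v
   + form_G X u v * form_L X u v)
  / (form_E X u v * form_G X u v - form_F X u v ^ 2).

(* [Derive] is total: where a partial derivative does not exist, the
   corresponding entry of the determinant is an arbitrary real number. *)
Definition jacobian (f h : R -> R -> R) (u v : R) : R :=
  partial_u f u v * partial_v h u v - partial_v f u v * partial_u h u v.

Definition weingarten (D : R -> R -> Prop) (X : surface) : Prop :=
  forall u v : R, D u v ->
    jacobian (relative_curvature X) (iso_mean_curvature X) u v = 0.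

Definition depends_only_on_u (D : R -> R -> Prop) (f : R -> R -> R) : Prop :=
  exists k : R -> R, forall u v : R, D u v -> f u v = k u.

Definition C2_at (g : R -> R) (u : R) : Prop :=
  (forall k : nat, (k <= 2)%nat -> ex_derive_n g k u)
  /\ continuous (Derive_n g 2) u.

(* The curves (u, 0, g u) and (0, u, g u) rotated by the angle v about the
   z-axis. *)
Definition rotational_xz (g : R -> R) : surface :=
  fun u v => (u * cos v, u * sin v, g u).
Definition rotational_yz (g : R -> R) : surface :=
  fun u v => (- u * sin v, u * cos v, g u).

(* Main.v *)
Require Import Defs.
From Stdlib Require Import Reals Lra FunctionalExtensionality.
From Coquelicot Require Import Coquelicot.
Open Scope R_scope.

(** Parametrize the surface as [(u c(v), u s(v), g(u))] with [c' = - s],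
    [s' = c], [c^2 + s^2 = 1]; both kinds of rotational surface are of this
    form. Regularity forces [u <> 0], and in the frame [X_u], [X_v], [e3]
    one has [X_uu = g'' e3], [X_uv = (1/u) X_v], [X_vv = - u X_u + u g' e3].
    Hence [K = g' g'' / u] and [H = g' / u + g''] do not involve [v], and both
    [v]-derivatives in the Jacobian vanish. *)

(** The determinant says that the projections of [p] and [q] to the xy-plane are independent. Since
    [e3] projects to zero, the first two coordinates determine [a] and [b], and the third then
    determines [l]. *)
Lemma normal_coef_unique (p q w : I3) (a b l : R) :
  px p * py q - py p * px q <> 0 ->
  w = I3_lin 1 (I3_lin a p b q) l e3 -> normal_coef p q w = l.
Proof.
  intros hd hw; unfold normal_coef.
  apply (iota_unique (V := R_CompleteNormedModule)); [| now exists a, b].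
  intros l' [a' [b' hw']].
  rewrite hw in hw'; unfold I3_lin, e3 in hw'.
  destruct p as [[p1 p2] p3], q as [[q1 q2] q3].
  unfold px, py, pz in *; simpl in *.
  injection hw' as h1 h2 h3.
  (* Cramer's rule: weighting the two horizontal equations by [q2] and [- q1] eliminates [b' - b]
     and leaves [a' - a] times the determinant. The weights for [b' - b] below are [p1] and
     [- p2]. *)
  assert (ha : a' = a).
  { apply Rminus_diag_uniq, (Rmult_eq_reg_r (p1 * q2 - p2 * q1)); [| exact hd].
    transitivity (((a' * p1 + b' * q1) - (a * p1 + b * q1)) * q2
                  - ((a' * p2 + b' * q2) - (a * p2 + b * q2)) * q1); [ring|].
    replace (a' * p1 + b' * q1) with (a * p1 + b * q1) by lra.
    replace (a' * p2 + b' * q2) with (a * p2 + b * q2) by lra.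
    ring. }
  assert (hb : b' = b).
  { apply Rminus_diag_uniq, (Rmult_eq_reg_r (p1 * q2 - p2 * q1)); [| exact hd].
    transitivity (((a' * p2 + b' * q2) - (a * p2 + b * q2)) * p1
                  - ((a' * p1 + b' * q1) - (a * p1 + b * q1)) * p2); [ring|].
    replace (a' * p1 + b' * q1) with (a * p1 + b * q1) by lra.
    replace (a' * p2 + b' * q2) with (a * p2 + b * q2) by lra.
    ring. }
  subst a' b'; lra.
Qed.

Definition revolution (c s g : R -> R) : surface :=
  fun u v => (u * c v, u * s v, g u).

(** The conclusion is an equality of functions, so it can serve as the first premise of a further
    application; this is how second derivatives are computed from first ones. *)
Lemma d_u_eq (X : surface) (x y z x' y' z' : R -> R -> R) :
  X = (fun u v => (x u v, y u v, z u v)) ->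
  (forall u v, Derive (fun t => x t v) u = x' u v) ->
  (forall u v, Derive (fun t => y t v) u = y' u v) ->
  (forall u v, Derive (fun t => z t v) u = z' u v) ->
  d_u X = fun u v => (x' u v, y' u v, z' u v).
Proof.
  intros -> hx hy hz; extensionality u; extensionality v.
  rewrite <- hx, <- hy, <- hz; reflexivity.
Qed.

Lemma d_v_eq (X : surface) (x y z x' y' z' : R -> R -> R) :
  X = (fun u v => (x u v, y u v, z u v)) ->
  (forall u v, Derive (fun t => x u t) v = x' u v) ->
  (forall u v, Derive (fun t => y u t) v = y' u v) ->
  (forall u v, Derive (fun t => z u t) v = z' u v) ->
  d_v X = fun u v => (x' u v, y' u v, z' u v).
Proof.
  intros -> hx hy hz; extensionality u; extensionality v.
  rewrite <- hx, <- hy, <- hz; reflexivity.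
Qed.

(** * Fundamental forms and curvatures of a surface of revolution *)

Section Revolution.

Variables c s g : R -> R.
Hypothesis c_derive : forall v, is_derive c v (- s v).
Hypothesis s_derive : forall v, is_derive s v (c v).
Hypothesis cs_unit : forall v, c v ^ 2 + s v ^ 2 = 1.

Let X := revolution c s g.

Let c_Derive (v : R) : Derive c v = - s v.
Proof. now apply is_derive_unique. Qed.

Let s_Derive (v : R) : Derive s v = c v.
Proof. now apply is_derive_unique. Qed.

Let Derive_id_scal_r (k u : R) : Derive (fun t => t * k) u = k.
Proof. rewrite Derive_scal_l, Derive_id; ring. Qed.

(** [Derive] is total and [Derive g] stays unevaluated, so the formula holds at every [u], also
    outside the interval where [g] is smooth. *)
Lemma revolution_u : d_u X = fun u v => (c v, s v, Derive g u).
Proof.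
  apply (d_u_eq _ _ _ _ (fun _ v => c v) (fun _ v => s v)
           (fun u _ => Derive g u) eq_refl); auto.
Qed.

Lemma revolution_v : d_v X = fun u v => (- u * s v, u * c v, 0).
Proof.
  apply (d_v_eq _ _ _ _ (fun u v => - u * s v) (fun u v => u * c v)
           (fun _ _ => 0) eq_refl); intros u v.
  - rewrite Derive_scal, c_Derive; ring.
  - now rewrite Derive_scal, s_Derive.
  - apply Derive_const.
Qed.

Lemma revolution_uu : d_u (d_u X) = fun u v => (0, 0, Derive (Derive g) u).
Proof.
  apply (d_u_eq _ _ _ _ (fun _ _ => 0) (fun _ _ => 0)
           (fun u _ => Derive (Derive g) u) revolution_u); intros u v.
  - apply Derive_const.
  - apply Derive_const.
  - reflexivity.
Qed.

Lemma revolution_uv : d_v (d_u X) = fun u v => (- s v, c v, 0).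
Proof.
  apply (d_v_eq _ _ _ _ (fun _ v => - s v) (fun _ v => c v)
           (fun _ _ => 0) revolution_u); intros u v.
  - apply c_Derive.
  - apply s_Derive.
  - apply Derive_const.
Qed.

Lemma revolution_vv : d_v (d_v X) = fun u v => (- u * c v, - u * s v, 0).
Proof.
  apply (d_v_eq _ _ _ _ (fun u v => - u * c v) (fun u v => - u * s v)
           (fun _ _ => 0) revolution_v); intros u v.
  - now rewrite Derive_scal, s_Derive.
  - rewrite Derive_scal, c_Derive; ring.
  - apply Derive_const.
Qed.

Lemma revolution_regular_neq0 (u v : R) : regular_at X u v -> u <> 0.
Proof.
  intros hreg hu.
  (* At [u = 0] the vector X_v vanishes, so the combination with coefficients 0 and 1 contradicts
     regularity. *)
  destruct (hreg 0 1) as [_ h]; [| lra].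
  rewrite revolution_v; unfold I3_lin, px, py, pz; simpl; subst u.
  apply (f_equal2 pair); [apply (f_equal2 pair) |]; ring.
Qed.

Lemma revolution_form_E (u v : R) : form_E X u v = 1.
Proof.
  unfold form_E; rewrite revolution_u; unfold iso_dot, px, py; simpl.
  rewrite <- (cs_unit v); ring.
Qed.

Lemma revolution_form_F (u v : R) : form_F X u v = 0.
Proof.
  unfold form_F; rewrite revolution_u, revolution_v.
  unfold iso_dot, px, py; simpl; ring.
Qed.

Lemma revolution_form_G (u v : R) : form_G X u v = u ^ 2.
Proof.
  unfold form_G; rewrite revolution_v; unfold iso_dot, px, py; simpl.
  transitivity (u ^ 2 * (c v ^ 2 + s v ^ 2)); [ring|].
  rewrite cs_unit; ring.
Qed.

(** The projections of X_u and X_v have determinant [u * (c v ^ 2 + s v ^ 2)], which is [u]. *)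
Lemma revolution_normal_coef (u v : R) (w : I3) (a b l : R) : u <> 0 ->
  w = I3_lin 1 (I3_lin a (d_u X u v) b (d_v X u v)) l e3 ->
  normal_coef (d_u X u v) (d_v X u v) w = l.
Proof.
  intros hu; apply normal_coef_unique.
  rewrite revolution_u, revolution_v; unfold px, py; simpl.
  replace (c v * (u * c v) - s v * (- u * s v))
    with (u * (c v ^ 2 + s v ^ 2)) by ring.
  rewrite cs_unit; lra.
Qed.

Lemma revolution_form_L (u v : R) : u <> 0 ->
  form_L X u v = Derive (Derive g) u.
Proof.
  intros hu; apply (revolution_normal_coef u v _ 0 0); [exact hu|].
  rewrite revolution_uu; unfold I3_lin, e3, px, py, pz; simpl.
  apply (f_equal2 pair); [apply (f_equal2 pair) |]; ring.
Qed.

Lemma revolution_form_M (u v : R) : u <> 0 -> form_M X u v = 0.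
Proof.
  intros hu; apply (revolution_normal_coef u v _ 0 (/ u)); [exact hu|].
  rewrite revolution_uv, revolution_u, revolution_v.
  unfold I3_lin, e3, px, py, pz; simpl.
  apply (f_equal2 pair); [apply (f_equal2 pair) |]; field; exact hu.
Qed.

Lemma revolution_form_N (u v : R) : u <> 0 ->
  form_N X u v = u * Derive g u.
Proof.
  (* The vector - u X_u matches X_vv horizontally but has height [- u * Derive g u], which the
     multiple of [e3] must cancel. *)
  intros hu; apply (revolution_normal_coef u v _ (- u) 0); [exact hu|].
  rewrite revolution_vv, revolution_u, revolution_v.
  unfold I3_lin, e3, px, py, pz; simpl.
  apply (f_equal2 pair); [apply (f_equal2 pair) |]; ring.
Qed.

Lemma revolution_relative_curvature (u v : R) : u <> 0 ->
  relative_curvature X u v = Derive g u * Derive (Derive g) u / u.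
Proof.
  intros hu; unfold relative_curvature.
  rewrite revolution_form_L, revolution_form_M, revolution_form_N by exact hu.
  rewrite revolution_form_E, revolution_form_F, revolution_form_G.
  field; exact hu.
Qed.

Lemma revolution_iso_mean_curvature (u v : R) : u <> 0 ->
  iso_mean_curvature X u v = Derive g u / u + Derive (Derive g) u.
Proof.
  intros hu; unfold iso_mean_curvature.
  rewrite revolution_form_L, revolution_form_M, revolution_form_N by exact hu.
  rewrite revolution_form_E, revolution_form_F, revolution_form_G.
  field; exact hu.
Qed.

End Revolution.

(** * The two kinds of rotational surface *)

Lemma rotational_xz_revolution (g : R -> R) :
  rotational_xz g = revolution cos sin g.
Proof. reflexivity. Qed.

Lemma rotational_yz_revolution (g : R -> R) :
  rotational_yz g = revolution (fun v => - sin v) cos g.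
Proof.
  extensionality u; extensionality v; unfold rotational_yz, revolution.
  apply (f_equal2 pair); [apply (f_equal2 pair) |]; ring.
Qed.

(** The second kind is the first with the angle advanced by a quarter turn, so its pair (- sin, cos)
    obeys the same differential equations as (cos, sin). *)
Lemma rotational_is_revolution (g : R -> R) (X : surface) :
  X = rotational_xz g \/ X = rotational_yz g ->
  exists c s : R -> R,
    X = revolution c s g
    /\ (forall v, is_derive c v (- s v))
    /\ (forall v, is_derive s v (c v))
    /\ (forall v, c v ^ 2 + s v ^ 2 = 1).
Proof.
  intros [-> | ->].
  - exists cos, sin; rewrite rotational_xz_revolution.
    split; [reflexivity | split; [| split]]; intros v.
    + apply is_derive_Reals, derivable_pt_lim_cos.
    + apply is_derive_Reals, derivable_pt_lim_sin.
    + rewrite <- (sin2_cos2 v); unfold Rsqr; ring.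
  - exists (fun v => - sin v), cos; rewrite rotational_yz_revolution.
    split; [reflexivity | split; [| split]]; intros v.
    + apply (is_derive_opp sin v (cos v)).
      apply is_derive_Reals, derivable_pt_lim_sin.
    + apply is_derive_Reals, derivable_pt_lim_cos.
    + rewrite <- (sin2_cos2 v); unfold Rsqr; ring.
Qed.

Lemma partial_v_eq0 (k : R) (f : R -> R -> R) (u v : R) :
  (forall t, f u t = k) -> partial_v f u v = 0.
Proof.
  intros hf; unfold partial_v.
  rewrite (Derive_ext _ (fun _ => k)) by exact hf.
  apply Derive_const.
Qed.

Theorem theorem3p1 (a b : Rbar) (g : R -> R) (X : surface)
  (hg : forall u : R, Rbar_lt a u -> Rbar_lt u b -> C2_at g u)
  (hg' : forall u : R, Rbar_lt a u -> Rbar_lt u b -> Derive g u <> 0)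
  (hX : X = rotational_xz g \/ X = rotational_yz g)
  (hreg : forall u v : R, Rbar_lt a u -> Rbar_lt u b -> regular_at X u v)
  (hadm : forall u v : R, Rbar_lt a u -> Rbar_lt u b -> admissible_at X u v) :
  let D := fun u v : R => Rbar_lt a u /\ Rbar_lt u b in
  depends_only_on_u D (relative_curvature X)
  /\ depends_only_on_u D (iso_mean_curvature X)
  /\ weingarten D X.
Proof.
  intros D.
  destruct (rotational_is_revolution g X hX) as [c [s [-> [hc [hs hcs]]]]].
  assert (hu : forall u v, D u v -> u <> 0).
  { intros u v [hau hub].
    apply (revolution_regular_neq0 c s g hc hs u v); now apply hreg. }
  assert (hK : forall u v, D u v -> relative_curvature (revolution c s g) u v
                 = Derive g u * Derive (Derive g) u / u).
  { intros u v hD; apply revolution_relative_curvature; eauto. }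
  assert (hH : forall u v, D u v -> iso_mean_curvature (revolution c s g) u v
                 = Derive g u / u + Derive (Derive g) u).
  { intros u v hD; apply revolution_iso_mean_curvature; eauto. }
  split; [| split].
  - now exists (fun u => Derive g u * Derive (Derive g) u / u).
  - now exists (fun u => Derive g u / u + Derive (Derive g) u).
  - intros u v hD; unfold jacobian.
    (* [D] puts no condition on the angle, so [hD] is also a proof of [D u t] for every [t], and the
       curvatures are constant along the whole parallel. *)
    rewrite (partial_v_eq0 _ (relative_curvature _) u v (fun t => hK u t hD)).
    rewrite (partial_v_eq0 _ (iso_mean_curvature _) u v (fun t => hH u t hD)).
    (* The u-derivatives would involve the third derivative of [g], which may fail to exist for a
       C^2 profile; whatever values [Derive] gives them, they are multiplied by zero. *)
    ring.
Qed.
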